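(* There exists an absolute constant $C > 0$ such that for every integer $n \ge 2$ and every measurable set $K \subseteq \mathbb{R}^n$ with $0 < \mathrm{vol}(K) < \infty$, $$\psi_K \le C\, n^{-1/2}.$$
   Context: ''Measurable'' means Borel measurable and $\mathrm{vol}$ is $n$-dimensional Lebesgue measure. For $x \in \mathbb{R}^n$, $\ell_0(x) = \#\{i \in \{1,\dots,n\} : x_i \ne 0\}$. Two sets $A, B \subseteq \mathbb{R}^n$ are axis-disjoint if $\ell_0(x-y) \ge 2$ for all $x \in A$, $y \in B$. For a measurable $K \subseteq \mathbb{R}^n$ with $\mathrm{vol}(K) > 0$, the $\ell_0$-isoperimetric coefficient of $K$ is $$\psi_K := \inf \frac{\mathrm{vol}(K \setminus (S_1 \cup S_2))}{\min\{\mathrm{vol}(S_1), \mathrm{vol}(S_2)\}},$$ the infimum being over all pairs of axis-disjoint measurable sets $S_1, S_2 \subseteq K$ with $\min\{\mathrm{vol}(S_1),\mathrm{vol}(S_2)\} > 0$. *)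

(* Defs.v *)
From HB Require Import structures.
From mathcomp Require Import all_boot all_order all_algebra.
From mathcomp Require Import all_classical all_reals all_analysis.

Set Implicit Arguments.
Unset Strict Implicit.
Unset Printing Implicit Defensive.

Import Order.TTheory GRing.Theory Num.Theory.
Import numFieldNormedType.Exports.

Local Open Scope classical_set_scope.
Local Open Scope ring_scope.

(* R^n is [n.-tuple R].  Its canonical sigma-algebra in the library is generated
   by the coordinate projections, i.e. it is the product of the Borel
   sigma-algebras of R; for finite n this is the Borel sigma-algebra of R^n. *)

(* n-dimensional Lebesgue measure as the n-fold product of Lebesgue measure on
   R, transported along R * R^m ~ R^m.+1; see [vol_box]. *)
Fixpoint vol (R : realType) (n : nat) : set (n.-tuple R) -> \bar R :=
  match n with
  | 0 => dirac [tuple]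
  | m.+1 => pushforward (product_measure1 lebesgue_measure (@vol R m))
              (fun p : R * m.-tuple R => [tuple of p.1 :: p.2])
  end.

Section vol_measure.
Context (R : realType).

Let consR (m : nat) (p : measurableTypeR R * m.-tuple R) : m.+1.-tuple R :=
  [tuple of p.1 :: p.2].

Let measurable_consR m : measurable_fun setT (@consR m).
Proof. exact: measurable_cons. Qed.

Let consR_box m (A : 'I_m.+1 -> set R) :
  @consR m @^-1` [set x | forall i, A i (tnth x i)] =
  A ord0 `*` [set x | forall i, A (lift ord0 i) (tnth x i)].
Proof.
apply/seteqP; split=> [[a x] /= H|[a x] /= [Ha H] i].
  split; first by have := H ord0; rewrite tnth0.
  by move=> i; have := H (lift ord0 i); rewrite tnthS.
case: (unliftP ord0 i) => [j ->|->]; last by rewrite tnth0.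
by rewrite tnthS; exact: H.
Qed.

Lemma measurable_box n (A : 'I_n -> set R) :
  (forall i, measurable (A i)) ->
  measurable [set x : n.-tuple R | forall i, A i (tnth x i)].
Proof.
move=> mA; rewrite (_ : mkset _ =
  \bigcap_(i in [set: 'I_n]) ((@tnth _ R ^~ i) @^-1` A i)); last first.
  by apply/seteqP; split=> x /= H i; [move=> _; exact: H|exact: H].
apply: fin_bigcap_measurable => // i _.
by rewrite -[X in measurable X]setTI; exact: measurable_tnth.
Qed.

Section vol_succ.
Context (m : nat) (mu : {sigma_finite_measure set (m.-tuple R) -> \bar R}).

Local Definition vol_step := pushforward (lebesgue_measure \x mu)%E (@consR m).

HB.instance Definition _ := Measure.copy vol_step
  (measure_function_pushforward__canonical__measure_function_Measure
    (lebesgue_measure \x mu)%E (@measurable_consR m)).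

Let vol_step_sigma_finite : sigma_finite setT vol_step.
Proof.
have /sigma_finiteP[F [TF ndF Foo]] := sigma_finiteT (@lebesgue_measure R).
have /sigma_finiteP[G [TG ndG Goo]] := sigma_finiteT mu.
pose FG k : set (m.+1.-tuple R) :=
  [set x | F k (thead x) /\ G k [tuple of behead x]].
have consFG k : @consR m @^-1` FG k = F k `*` G k.
  apply/seteqP; split=> -[a x] /=; rewrite /FG /= theadE.
    by case=> Fa; rewrite (_ : [tuple of _] = x)//; exact: val_inj.
  by case=> Fa Gx; split=> //; rewrite (_ : [tuple of _] = x)//; exact: val_inj.
exists FG.
  apply/seteqP; split=> // x _.
  have : setT (thead x) by [].
  rewrite TF => -[i _ Fix].
  have : setT [tuple of behead x] by [].
  rewrite TG => -[j _ Gjx].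
  exists (maxn i j) => //; split.
    by move: Fix; exact/subsetPset/ndF/leq_maxl.
  by move: Gjx; exact/subsetPset/ndG/leq_maxr.
move=> k; have [mF Fk] := Foo k; have [mG Gk] := Goo k; split.
  rewrite (_ : FG k =
    ((@tnth _ R ^~ ord0) @^-1` F k) `&`
    ((fun x : m.+1.-tuple R => [tuple of behead x]) @^-1` G k))//.
  apply: measurableI; rewrite -[X in measurable X]setTI.
    exact: measurable_tnth.
  exact: measurable_behead.
rewrite /vol_step /pushforward consFG product_measure1E//.
by rewrite lte_mul_pinfty// ge0_fin_numE.
Qed.

HB.instance Definition _ := Measure_isSigmaFinite.Build _ _ _ vol_step
  vol_step_sigma_finite.

End vol_succ.

Let vol_spec n :
  {mu : {sigma_finite_measure set (n.-tuple R) -> \bar R} |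
    mu = @vol R n :> (set _ -> \bar R)}.
Proof.
elim: n => [|m [mu muE]]; first by exists (dirac [tuple]).
by exists (vol_step mu); rewrite /= -muE.
Qed.

Let vol0 n : @vol R n set0 = 0%E.
Proof. by have [mu <-] := vol_spec n; rewrite measure0. Qed.

Let vol_ge0 n A : (0 <= @vol R n A)%E.
Proof. by have [mu <-] := vol_spec n; exact: measure_ge0. Qed.

Let vol_sigma_additive n : semi_sigma_additive (@vol R n).
Proof. by have [mu <-] := vol_spec n; exact: measure_semi_sigma_additive. Qed.

HB.instance Definition _ n := isMeasure.Build _ _ _ (@vol R n)
  (@vol0 n) (@vol_ge0 n) (@vol_sigma_additive n).

Let vol_sigma_finite n : sigma_finite setT (@vol R n).
Proof. by have [mu <-] := vol_spec n; exact: sigma_finiteT. Qed.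

HB.instance Definition _ n := Measure_isSigmaFinite.Build _ _ _ (@vol R n)
  (@vol_sigma_finite n).

Lemma vol_box n (A : 'I_n -> set R) : (forall i, measurable (A i)) ->
  vol [set x : n.-tuple R | forall i, A i (tnth x i)] =
  (\prod_(i < n) lebesgue_measure (A i))%E.
Proof.
elim: n A => [|n IHn] A mA.
  by rewrite big_ord0 /= diracE mem_set//= => -[].
rewrite big_ord_recl -IHn; last by move=> i; exact: mA.
rewrite /= /pushforward; have := @consR_box n A; rewrite /consR => ->.
rewrite product_measure1E//; first exact: mA.
exact: (@measurable_box _ (fun i => A (lift ord0 i)) (fun i => mA _)).
Qed.

End vol_measure.

Definition l0 (R : realType) (n : nat) (x : n.-tuple R) : nat :=
  #|[pred i : 'I_n | tnth x i != 0]|.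

Definition axis_disjoint (R : realType) (n : nat) (A B : set (n.-tuple R)) :=
  forall x y, A x -> B y -> (2 <= l0 [tuple (tnth x i - tnth y i)%R | i < n])%N.

(* The l_0-isoperimetric coefficient of K, as an extended real: +oo if K contains
   no admissible pair (S1, S2). *)
Definition psi (R : realType) (n : nat) (K : set (n.-tuple R)) : \bar R :=
  ereal_inf [set r | exists S1 S2 : set (n.-tuple R),
    [/\ measurable S1, measurable S2, S1 `<=` K & S2 `<=` K] /\
    [/\ axis_disjoint S1 S2, (0 < mine (vol S1) (vol S2))%E &
        r = (vol (K `\` (S1 `|` S2)) / mine (vol S1) (vol S2))%E]].

(* Main.v *)
Require Import Defs.
From mathcomp Require Import all_boot all_order all_algebra.
From mathcomp Require Import zify lra.

(* Cut every coordinate axis into cells of length 1/(j+1), colour the cells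
   alternately, and let f_j(x) be the number of coordinates of x lying in an
   odd cell.  Moving one coordinate changes f_j by at most 1, so the slices
   {f_j < n/2} and {f_j > n/2} of K are axis-disjoint.  As j tends to infinity
   the 2^n colour patterns become equidistributed in every set of finite volume:
   f_j restricted to K converges in law to a binomial (n, 1/2) variable.  Hence
   the removed slice {f_j = n/2} has relative volume close to
   C(n, n/2) / 2^n <= n^(-1/2), while the other two have relative volume bounded
   below. *)

Set Implicit Arguments.
Unset Strict Implicit.
Unset Printing Implicit Defensive.

(** * Central binomial coefficients and layers of the Boolean lattice *)

Lemma bin_doubleS m : 'C(m.+1.*2, m.+1) = 2 * 'C(m.*2.+1, m).
Proof.
apply/eqP; rewrite -(eqn_pmul2l (ltn0Sn m)) -mul_bin_diag doubleS /=.
by rewrite mulnA; apply/eqP; congr (_ * _); lia.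
Qed.

(** As (m+1) C(2m+2, m+1) = 2 (2m+1) C(2m, m), the induction step comes down to (2m+1)(2m+3) <=
    (2m+2)^2. *)
Lemma central_bin_sqr_le m : 'C(m.*2, m) ^ 2 * m.*2.+1 <= 4 ^ m.*2.
Proof.
elim: m => [//|m IH].
have binE : m.+1 * 'C(m.*2.+1, m) = m.*2.+1 * 'C(m.*2, m).
  by have := mul_bin_down m.*2.+1 m; rewrite /= => ->; congr (_ * _); lia.
have -> : 4 ^ m.+1.*2 = 16 * 4 ^ m.*2 by rewrite doubleS !expnS mulnA.
rewrite bin_doubleS -!mulnn in IH binE *.
set c := 'C(m.*2, m) in IH binE *; set d := 'C(_, m) in binE *.
set q := 4 ^ _ in IH *.
rewrite -(leq_pmul2l (ltn0Sn m)) -(leq_pmul2l (ltn0Sn m)).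
have -> : m.+1 * (m.+1 * (2 * d * (2 * d) * m.+1.*2.+1)) =
    4 * ((m.+1 * d) * (m.+1 * d)) * m.+1.*2.+1 by lia.
rewrite binE.
have -> : 4 * (m.*2.+1 * c * (m.*2.+1 * c)) * m.+1.*2.+1 =
    c * c * m.*2.+1 * (4 * m.*2.+1 * m.+1.*2.+1) by lia.
apply: leq_trans (leq_mul IH (leqnn _)) _.
by rewrite mulnC (mulnA m.+1) mulnA leq_mul2r; apply/orP; right; lia.
Qed.

(** For odd [n] = 2m+1 this is the central bound at m+1 divided by 4, because C(2m+2, m+1) = 2
    C(2m+1, m). *)
Lemma middle_bin_sqr_le n : 'C(n, n./2) ^ 2 * (uphalf n).*2.+1 <= 4 ^ n.
Proof.
have := odd_double_half n; set m := n./2; case: (odd n) => /= nE; rewrite -nE.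
  have := central_bin_sqr_le m.+1; rewrite bin_doubleS add1n.
  have -> : uphalf m.*2.+1 = m.+1 by lia.
  by rewrite expnMn -mulnA doubleS [4 ^ _]expnS leq_mul2l.
by rewrite add0n uphalf_double; exact: central_bin_sqr_le.
Qed.

Section Layers.
Variable n : nat.
Implicit Type S : {set 'I_n}.

(** For odd [n] the threshold is rounded down: the upper layers then make up half of the lattice and
    the lower layers are the smaller side. *)
Definition lower_layers := [set S : {set 'I_n} | #|S| < n./2].
Definition middle_layer := [set S : {set 'I_n} | #|S| == n./2].
Definition upper_layers := [set S : {set 'I_n} | n./2 < #|S|].

Lemma card_middle_layer : #|middle_layer| = 'C(n, n./2).
Proof. by rewrite card_draws card_ord. Qed.

Lemma card_layers : #|lower_layers| + #|middle_layer| + #|upper_layers| = 2 ^ n.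
Proof.
rewrite -[in RHS](card_ord n) -cardsT -card_powerset.
rewrite -(cardsID (~: upper_layers) (powerset _)).
rewrite -(cardsID lower_layers (powerset _ :&: _)).
by congr (_ + _ + _); apply: eq_card => S; rewrite !inE subsetT /=; lia.
Qed.

(** Complementation maps the lower layers injectively into the upper ones. *)
Lemma card_lower_le_upper : #|lower_layers| <= #|upper_layers|.
Proof.
rewrite -(card_imset (mem lower_layers) (inv_inj (@setCK _))).
apply/subset_leq_card/subsetP => _ /imsetP[S + ->].
by rewrite !inE; have := cardsC S; rewrite card_ord; lia.
Qed.

(** Complementation is injective and sends a set with more than [n./2] elements to one with at most
    [n./2]. *)
Lemma card_upper_le : #|upper_layers| <= #|lower_layers| + #|middle_layer|.
Proof.
rewrite -(card_imset (mem upper_layers) (inv_inj (@setCK _))).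
apply: leq_trans (leq_card_setU _ _).
apply/subset_leq_card/subsetP => _ /imsetP[S + ->].
by rewrite !inE; have := cardsC S; rewrite card_ord; lia.
Qed.

(** By [card_upper_le] the lower and middle layers together hold at least half of all subsets, so a
    middle layer of at most 9/20 of the total leaves 1/20 for the lower ones. For [n = 2] the middle
    layer is exactly half, hence the separate case. *)
Lemma card_lower_layers : 1 < n -> 2 ^ n <= 20 * #|lower_layers|.
Proof.
have := card_layers; have := card_upper_le.
rewrite card_middle_layer => H1 H2 n1.
have [n2|n3] := eqVneq n 2.
  have q4 : 2 ^ n = 4 by rewrite n2.
  have : 0 < #|lower_layers|.
    by apply/card_gt0P; exists set0; rewrite inE cards0; lia.
  by rewrite q4; lia.
have := middle_bin_sqr_le n; set c := 'C(_, _) in H1 H2 *.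
have -> : 4 ^ n = 2 ^ n * 2 ^ n by rewrite -expnMn.
have : 5 <= (uphalf n).*2.+1 by lia.
set u := _.+1; set q := 2 ^ n in H2 * => u5; rewrite expnSr expn1 => H.
(* Since 1/5 < (9/20)^2, this yields 20 c <= 9 q. *)
have : c * c * 5 <= q * q by apply: leq_trans H; rewrite leq_mul2l u5 orbT.
have : 10 * (2 * c) <= 9 * q -> q <= 20 * #|lower_layers| by lia.
move=> + H3; apply; rewrite leqNgt; apply/negP; nia.
Qed.
End Layers.

From mathcomp Require Import all_classical all_reals all_analysis.
From mathcomp Require Import measurable_realfun.

Import Order.TTheory GRing.Theory Num.Theory.
Import numFieldNormedType.Exports.

Local Open Scope classical_set_scope.
Local Open Scope ring_scope.

(** * Sequences of sets taking a fixed asymptotic proportion *)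

Section Mixing.
Context d (T : measurableType d) (R : realType).
Variable mu : {measure set T -> \bar R}.
Implicit Types (A : (set T)^nat) (p q : R) (E : set T).

(** Asked of every [E] of finite measure, this is weak-* convergence of the indicators of [A j] to
    the constant [p]. Because of [fine] it is meaningful only when [mu E] is finite. *)
Definition mixing A p E :=
  fine (mu (E `&` A j)) @[j --> \oo] --> p * fine (mu E).

Lemma sub_measure_lty E F : (mu F < +oo)%E -> measurable E -> measurable F ->
  E `<=` F -> (mu E < +oo)%E.
Proof. by move=> + mE mF EF; apply: le_lt_trans; rewrite le_measure ?inE. Qed.

Lemma fine_measureDI E F : measurable E -> measurable F -> (mu E < +oo)%E ->
  fine (mu E) = fine (mu (E `\` F)) + fine (mu (E `&` F)).
Proof.
move=> mE mF Eoo; rewrite (measureDI _ mE mF) fineD// ge0_fin_numE//.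
  by apply: (sub_measure_lty Eoo) => //; exact: measurableD.
by apply: (sub_measure_lty Eoo) => //; exact: measurableI.
Qed.

Lemma le_fine_measure E F : measurable E -> measurable F ->
  E `<=` F -> (mu F < +oo)%E -> fine (mu E) <= fine (mu F).
Proof.
move=> mE mF EF Foo; have Eoo := sub_measure_lty Foo mE mF EF.
by apply: fine_le; rewrite ?ge0_fin_numE// le_measure ?inE.
Qed.

Lemma mixing_setC A p E : (forall j, measurable (A j)) -> measurable E ->
  (mu E < +oo)%E -> mixing A p E -> mixing (fun j => ~` A j) (1 - p) E.
Proof.
move=> mA mE Eoo AE; rewrite /mixing mulrBl mul1r.
under eq_fun => j.
  have -> : fine (mu (E `&` ~` A j)) = fine (mu E) - fine (mu (E `&` A j)).
    by rewrite (fine_measureDI mE (mA j) Eoo) addrK setDE.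
  over.
by apply: cvgB => //; exact: cvg_cst.
Qed.

Lemma mixing_setU A B p q E :
  (forall j, measurable (A j)) -> (forall j, measurable (B j)) ->
  (forall j, A j `&` B j = set0) -> measurable E -> (mu E < +oo)%E ->
  mixing A p E -> mixing B q E -> mixing (fun j => A j `|` B j) (p + q) E.
Proof.
move=> mA mB AB mE Eoo AE BE; rewrite /mixing mulrDl.
under eq_fun => j.
  have -> : fine (mu (E `&` (A j `|` B j))) =
      fine (mu (E `&` A j)) + fine (mu (E `&` B j)).
    rewrite (@fine_measureDI (E `&` (A j `|` B j)) (B j))//.
    - congr (fine (mu _) + fine (mu _)); apply/seteqP; split=> x /=.
      + by case=> -[Ex []].
      + case=> Ex Ax; split; first by split; [|left].
        by move=> Bx; suff : set0 x by []; rewrite -(AB j).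
      + by case=> -[].
      + by case=> Ex Bx; split=> //; split; [|right].
    - by apply: measurableI => //; exact: measurableU.
    - apply: (sub_measure_lty Eoo) => //; apply: measurableI => //.
      exact: measurableU.
  over.
exact: cvgD.
Qed.

Lemma mixing_setD A p E F : (forall j, measurable (A j)) -> measurable E ->
  measurable F -> F `<=` E -> (mu E < +oo)%E ->
  mixing A p E -> mixing A p F -> mixing A p (E `\` F).
Proof.
move=> mA mE mF FE Eoo AE AF; rewrite /mixing.
have EF : E `&` F = F by exact: setIidr.
have -> : fine (mu (E `\` F)) = fine (mu E) - fine (mu F).
  by rewrite (fine_measureDI mE mF Eoo) EF addrK.
rewrite mulrBr; under eq_fun => j.
  have -> : fine (mu ((E `\` F) `&` A j)) =
      fine (mu (E `&` A j)) - fine (mu (F `&` A j)).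
    rewrite (@fine_measureDI (E `&` A j) F)//.
    - by rewrite setIAC EF addrK !setDE setIAC.
    - exact: measurableI.
    - by apply: (sub_measure_lty Eoo) => //; exact: measurableI.
  over.
exact: cvgB.
Qed.

(** A three-epsilon argument: replacing the union by [E k] changes both sides by at most the measure
    of the difference, uniformly in [j]. *)
Lemma mixing_bigcup A p (E : (set T)^nat) : 0 <= p <= 1 ->
  (forall j, measurable (A j)) -> (forall k, measurable (E k)) ->
  nondecreasing_seq E -> (mu (\bigcup_k E k) < +oo)%E ->
  (forall k, mixing A p (E k)) -> mixing A p (\bigcup_k E k).
Proof.
move=> /andP[p0 p1] mA mE ndE; set F := \bigcup_k E k => Foo AE.
have mF : measurable F by exact: bigcup_measurable.
have muF : fine (mu (E k)) @[k --> \oo] --> fine (mu F).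
  apply: fine_cvg; rewrite fineK ?ge0_fin_numE//.
  exact: (nondecreasing_cvg_mu mE mF ndE).
apply/cvgrPdist_le => e e0.
have e3 : 0 < e / 3 by lra.
have /cvgrPdist_le/(_ _ e3)[k _ /(_ k (leqnn k)) kF] := muF.
have EF : E k `<=` F by exact: bigcup_sup.
have /cvgrPdist_le/(_ _ e3) := AE k.
apply: filterS => j.
have mEA : measurable (E k `&` A j) by exact: measurableI.
have mFA : measurable (F `&` A j) by exact: measurableI.
have FAoo : (mu (F `&` A j) < +oo)%E.
  by apply: (sub_measure_lty Foo) => //; exact: subIsetl.
have H1 : fine (mu (E k `&` A j)) <= fine (mu (F `&` A j)).
  by apply: le_fine_measure => //; exact: setSI.
have H2 : fine (mu (F `&` A j)) - fine (mu (E k `&` A j)) <=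
    fine (mu F) - fine (mu (E k)).
  rewrite (fine_measureDI mFA (mE k) FAoo) (fine_measureDI mF (mE k) Foo).
  rewrite setIAC (setIidr EF) !addrK.
  apply: le_fine_measure; [exact: measurableD|exact: measurableD| |].
    by apply: setSD; exact: subIsetl.
  by apply: (sub_measure_lty Foo) => //; exact: measurableD.
have H3 := le_fine_measure (mE k) mF EF Foo.
have H4 : p * fine (mu (E k)) <= p * fine (mu F) by rewrite ler_wpM2l.
have H5 : p * fine (mu F) - p * fine (mu (E k)) <=
    fine (mu F) - fine (mu (E k)).
  by rewrite -mulrBr ler_piMl// subr_ge0.
rewrite ler_norml in kF; case/andP: kF => _ kF.
rewrite !ler_norml => /andP[]; lra.
Qed.

(** Inside a fixed [D k] all measures are finite, so the sets whose trace on [D k] satisfies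
    [mixing] form a lambda-system containing the pi-system [G]. The exhaustion by the [D k] then
    removes the truncation. *)
Lemma mixing_pi_lambda A p (G : set (set T)) (D : (set T)^nat) : 0 <= p <= 1 ->
  (forall j, measurable (A j)) ->
  G `<=` measurable -> measurable `<=` <<s G >> -> setI_closed G ->
  (forall E, G E -> (mu E < +oo)%E /\ mixing A p E) ->
  (forall k, G (D k)) -> nondecreasing_seq D -> \bigcup_k D k = setT ->
  forall E, measurable E -> (mu E < +oo)%E -> mixing A p E.
Proof.
move=> p01 mA Gm mG GI GA GD ndD TD E mE Eoo.
have Doo k : (mu (D k) < +oo)%E by have [] := GA _ (GD k).
have IDoo F k : measurable F -> (mu (F `&` D k) < +oo)%E.
  move=> mF; apply: (sub_measure_lty (Doo k)); last exact: subIsetr.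
    by apply: measurableI => //; exact: Gm.
  exact: Gm.
have AED k : mixing A p (E `&` D k).
  pose H := [set F | measurable F /\ mixing A p (F `&` D k)].
  suff: H E by case.
  apply: (@lambda_system_subset _ G GI setT H _ _ _ E (mG _ mE)) => //.
  - split => //.
    + by split=> //; rewrite setTI; have [] := GA _ (GD k).
    + move=> F F' FF' [mF AF] [mF' AF']; split; first exact: measurableD.
      rewrite (_ : _ `&` _ = (F `&` D k) `\` (F' `&` D k)).
        apply: mixing_setD => //; [| |exact: setSI|exact: IDoo];
          by apply: measurableI => //; exact: Gm.
      apply/seteqP; split=> x /=; first by case=> -[Fx xF'] Dx; split=> // -[].
      by case=> -[Fx Dx] xFD'; split=> //; split=> // F'x; exact: xFD'.
    + move=> F ndF HF; have mF i := (HF i).1.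
      split; first exact: bigcup_measurable.
      rewrite setI_bigcupl; apply: mixing_bigcup => //.
      * by move=> i; apply: measurableI => //; exact: Gm.
      * by move=> i j ij; apply/subsetPset; apply: setSI; exact/subsetPset/ndF.
      * by rewrite -setI_bigcupl; apply: IDoo; exact: bigcup_measurable.
      * by move=> i; case: (HF i).
  - move=> F GF; split; first exact: Gm.
    by have [] := GA _ (GI _ _ GF (GD k)).
rewrite -(setIT E) -TD setI_bigcupr; apply: mixing_bigcup => //.
- by move=> i; apply: measurableI => //; exact: Gm.
- by move=> i j ij; apply/subsetPset; apply: setIS; exact/subsetPset/ndD.
- by rewrite -setI_bigcupr TD setIT.
Qed.

End Mixing.

(** * Equidistribution of the alternating colouring of the line *)

Section Lebesgue_measure_1D.
Context (R : realType).
Notation mu := (@lebesgue_measure R).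

Lemma measurable_shift (h : R) :
  measurable_fun setT (fun x : measurableTypeR R => x + h : measurableTypeR R).
Proof. by apply: measurable_funD => //; exact: measurable_cst. Qed.

(** The pushforward under a translation agrees with Lebesgue measure on half-open intervals, and
    uniqueness concludes. *)
Lemma lebesgue_measure_shift (h : R) (A : set (measurableTypeR R)) :
  measurable A -> mu ((fun x => x + h) @^-1` A) = mu A.
Proof.
move=> mA.
pose nu : {measure set (measurableTypeR R) -> \bar R} :=
  measure_function_pushforward__canonical__measure_function_Measure mu
    (measurable_shift h).
apply/esym/(@lebesgue_measure_unique _ nu) => // _ [[a b] _ <-].
rewrite /nu /= /pushforward /= (_ : _ @^-1` _ = `]a - h, b - h]%classic).
  rewrite !lebesgue_measure_itv /= !lte_fin ltrD2r; case: ifP => // _.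
  by rewrite -!EFinD; congr EFin; lra.
by apply/seteqP; split=> x /=; rewrite !in_itv /= ltrBlDr lerBrDr.
Qed.

(** The colour is the parity of the cell index; the absolute value preserves parity at negative
    indices. *)
Definition odd_cells (j : nat) : set (measurableTypeR R) :=
  [set t | odd `|Num.floor (j.+1%:R * t)|].

Lemma odd_cells_shift j t : odd_cells j (t + j.+1%:R^-1) <-> ~ odd_cells j t.
Proof.
rewrite /odd_cells /= mulrDr mulfV ?pnatr_eq0// floorDrz ?floor1; last first.
  exact: intr_int 1.
split; first by move=> + /[dup]; case: (Num.floor _) => z /=; lia.
by move/negP; case: (Num.floor _) => z /=; lia.
Qed.

Lemma measurable_odd_cells j : measurable (odd_cells j).
Proof.
pose F (z : int) : set (measurableTypeR R) :=
  if odd `|z| then `[z%:~R / j.+1%:R, (z + 1)%:~R / j.+1%:R[%classic else set0.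
rewrite (_ : odd_cells j = \bigcup_z F z).
  apply: countable_bigcupT_measurable; first exact: countableP.
  by move=> z; rewrite /F; case: ifP.
have FE z t : F z t <-> odd `|z| /\ Num.floor (j.+1%:R * t) = z.
  rewrite /F; case: ifP => oz; last by split=> // -[].
  rewrite /= in_itv /= ler_pdivrMr// ltr_pdivlMr// [t * _]mulrC -floor_eq.
  by split=> [/eqP ->|[_ ->]].
apply/seteqP; split=> t.
  by move=> ot; exists (Num.floor (j.+1%:R * t)) => //; apply/FE.
by case=> z _ /FE[oz tz]; rewrite /odd_cells /= tz.
Qed.

Lemma lebesgue_measure_itv_oc_lty (a b : R) : (mu `]a, b] < +oo)%E.
Proof. by rewrite lebesgue_measure_itv /=; case: ifP => _; rewrite ?ltry. Qed.

(* Translating by j.+1%:R^-1 exchanges the odd and the even cells, and moves at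
   most that much mass out of the interval. *)
Lemma odd_cells_itv j (a b : R) :
  `|2^-1 * fine (mu `]a, b]) - fine (mu (`]a, b] `&` odd_cells j))| <=
  j.+1%:R^-1.
Proof.
set h := j.+1%:R^-1; have h0 : 0 < h by rewrite invr_gt0.
set I := [set` `]a, b]].
have mI : measurable (I : set (measurableTypeR R)) by exact: measurable_itv.
have Ioo := lebesgue_measure_itv_oc_lty a b.
have mO := measurable_odd_cells j.
have mOC := measurableC mO.
have shiftI (P Q : set (measurableTypeR R)) : measurable P -> measurable Q ->
    (forall t, P (t + h) -> Q t) ->
    fine (mu (I `&` P)) <= fine (mu (I `&` Q)) + h.
  move=> mP mQ PQ.
  have mIP := measurableI _ _ mI mP.
  have mIQ := measurableI _ _ mI mQ.
  have mshift :
      measurable ((fun t : measurableTypeR R => t + h) @^-1` (I `&` P)).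
    by rewrite -[X in measurable X]setTI; exact: measurable_shift.
  (* [J] contains the points outside [I] that the translation brings into [I]. *)
  pose J : set (measurableTypeR R) := `]a - h, a]%classic.
  have mJ : measurable J by exact: measurable_itv.
  have muJ : fine (mu J) = h.
    by rewrite lebesgue_measure_itv /= lte_fin ifT /=; lra.
  rewrite -(lebesgue_measure_shift h mIP) -[X in _ <= _ + X]muJ.
  rewrite -fineD; last 2 first.
  - rewrite ge0_fin_numE//; apply: (sub_measure_lty Ioo) => //.
  - by rewrite ge0_fin_numE//; exact: lebesgue_measure_itv_oc_lty.
  apply: fine_le.
  - rewrite lebesgue_measure_shift// ge0_fin_numE//.
    exact: (sub_measure_lty Ioo).
  - rewrite fin_numD !ge0_fin_numE//; apply/andP; split.
      exact: (sub_measure_lty Ioo).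
    exact: lebesgue_measure_itv_oc_lty.
  apply: le_trans (measureU2 _ mIQ mJ).
  rewrite le_measure ?inE//; first exact: measurableU.
  move=> t /= []; rewrite /I /J /= !in_itv /= => /andP[at_ tb] /PQ Qt.
  case: (leP t a) => ta; [right; lra|left; split=> //; lra].
have H1 := shiftI _ _ mO mOC (fun t => (odd_cells_shift j t).1).
have H2 : fine (mu (I `&` ~` odd_cells j)) <= fine (mu (I `&` odd_cells j)) + h.
  by apply: shiftI => // t nO; apply: contrapT => /odd_cells_shift.
(* The two colours differ by at most [h] in measure and add up to the interval. *)
have := fine_measureDI mI mO Ioo; rewrite setDE => ->.
by rewrite ler_norml; apply/andP; split; lra.
Qed.

(** Half-open intervals are the generating pi-system; on each of them [odd_cells_itv] gives an error
    tending to 0. *)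
Lemma mixing_odd_cells (E : set (measurableTypeR R)) : measurable E ->
  (mu E < +oo)%E -> mixing mu odd_cells 2^-1 E.
Proof.
move: E; pose D (k : nat) : set (measurableTypeR R) := `]- k%:R, k%:R]%classic.
have := @mixing_pi_lambda _ _ _ mu odd_cells 2^-1 (@ocitv R) D.
apply => //.
- by apply/andP; split; lra.
- exact: measurable_odd_cells.
- by move=> A oA; exact: sub_sigma_algebra.
- exact: ocitvI.
- move=> _ [[a b] _ <-]; split; first exact: lebesgue_measure_itv_oc_lty.
  apply/cvgrPdist_le => e e0; near=> j.
  apply: le_trans (odd_cells_itv _ _ _) _.
  near: j.
  have /cvgrPdist_le/(_ _ e0) := @cvg_harmonic R.
  by apply: filterS => j; rewrite sub0r normrN ger0_norm ?harmonic_ge0.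
- by move=> k; exists (- k%:R, k%:R).
- move=> k l kl; apply/subsetPset => t.
  rewrite /D /= !in_itv /= => /andP[H1 H2].
  have : k%:R <= l%:R :> R by rewrite ler_nat.
  by move=> ?; apply/andP; split; lra.
- apply/seteqP; split=> // t _; exists (Num.bound `|t|) => //.
  rewrite /D /= in_itv /=; have : `|t| < (Num.bound `|t|)%:R.
    by apply: archi_boundP.
  by rewrite ltr_norml => /andP[? ?]; apply/andP; split; lra.
Unshelve. all: by end_near. Qed.

End Lebesgue_measure_1D.

(** * Equidistribution of colour patterns in R^n *)

Section Pattern.
Context (R : realType) (n : nat).
Notation mu := (@lebesgue_measure R).
Implicit Types (A : 'I_n -> set (measurableTypeR R)) (S : {set 'I_n}).

Definition box A : set (n.-tuple R) := [set x | forall i, A i (tnth x i)].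

Lemma boxI A B : box A `&` box B = box (fun i => A i `&` B i).
Proof.
apply/seteqP; split=> x /= => [[Ax Bx] i|ABx]; first by split.
by split=> i; case: (ABx i).
Qed.

(** Sides are arbitrary measurable sets of finite measure, so cutting a box by a product of cells
    again gives a finite box. *)
Definition finite_box := [set box A | A in
  [set A | forall i, measurable (A i) /\ (mu (A i) < +oo)%E]].

Lemma finite_box_measurable : finite_box `<=` measurable.
Proof. by move=> _ [A mA <-]; apply: measurable_box => i; case: (mA i). Qed.

Lemma setI_closed_finite_box : setI_closed finite_box.
Proof.
move=> _ _ [A mA <-] [B mB <-]; rewrite boxI.
exists (fun i => A i `&` B i) => // i.
have [mAi Aioo] := mA i; have [mBi _] := mB i.
split; first exact: measurableI.
by apply: (sub_measure_lty Aioo) => //; exact: measurableI.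
Qed.

Definition cube (k : nat) := box (fun=> `]- k%:R, k%:R]%classic).

Lemma finite_box_cube k : finite_box (cube k).
Proof.
exists (fun=> `]- k%:R, k%:R]%classic) => // i.
split; first exact: measurable_itv.
exact: lebesgue_measure_itv_oc_lty.
Qed.

Lemma nondecreasing_cube : nondecreasing_seq cube.
Proof.
move=> k l kl; apply/subsetPset => x /= kx i; move: (kx i).
rewrite /= !in_itv /= => /andP[H1 H2].
have : k%:R <= l%:R :> R by rewrite ler_nat.
by move=> ?; apply/andP; split; lra.
Qed.

Lemma bigcup_cube : \bigcup_k cube k = setT.
Proof.
apply/seteqP; split=> // x _.
exists (\max_(i < n) Num.bound `|tnth x i|)%N => // i.
rewrite /= in_itv /=; set k := (\max_(_ < _) _)%N.
have : `|tnth x i| < k%:R.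
  apply: (@lt_le_trans _ _ (Num.bound `|tnth x i|)%:R).
    exact: archi_boundP.
  by rewrite ler_nat; exact: leq_bigmax.
by rewrite ltr_norml => /andP[? ?]; apply/andP; split; lra.
Qed.

(** A generating coordinate cylinder may have infinite volume, but it is the union of its
    truncations to the cubes, which are finite boxes. *)
Lemma measurable_finite_box : measurable `<=` <<s finite_box >>.
Proof.
apply: smallest_sub; first exact: smallest_sigma_algebra.
rewrite -bigcup_seq => E [i _ [B mB <-]].
pose A k l : set (measurableTypeR R) :=
  if l == i then B `&` `]- k%:R, k%:R] else `]- k%:R, k%:R]%classic.
rewrite (_ : _ `&` _ = \bigcup_k box (A k)).
  apply: sigma_algebra_bigcup => k; apply: sub_sigma_algebra.
  exists (A k) => // l; rewrite /A; case: ifP => _; last first.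
    by split; [exact: measurable_itv|exact: lebesgue_measure_itv_oc_lty].
  split; first by apply: measurableI => //; exact: measurable_itv.
  apply: (sub_measure_lty (lebesgue_measure_itv_oc_lty (- k%:R) k%:R)) => //.
  by apply: measurableI => //; exact: measurable_itv.
apply/seteqP; split=> x /=.
  case=> _ Bx; have : setT x by [].
  rewrite -bigcup_cube => -[k _ kx]; exists k => // l; rewrite /A.
  by case: eqP => [->|_]; [split=> //; exact: kx|exact: kx].
by case=> k _ /(_ i); rewrite /A eqxx => -[].
Qed.

(** The cardinality of the pattern is the function f_j; the whole set is kept because its fibers,
    unlike those of f_j, are boxes. *)
Definition pattern (j : nat) (x : n.-tuple R) : {set 'I_n} :=
  [set i | tnth x i \in odd_cells j]%SET.

Definition cell (b : bool) (j : nat) : set (measurableTypeR R) :=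
  if b then odd_cells j else ~` odd_cells j.

Lemma measurable_cell b j : measurable (cell b j).
Proof.
by case: b; rewrite /cell; [|apply: measurableC]; exact: measurable_odd_cells.
Qed.

Lemma mixing_cell b (E : set (measurableTypeR R)) : measurable E ->
  (mu E < +oo)%E -> mixing mu (cell b) 2^-1 E.
Proof.
move=> mE Eoo; case: b; first exact: mixing_odd_cells.
rewrite (_ : 2^-1 = 1 - 2^-1 :> R); last by lra.
apply: mixing_setC => //; first exact: measurable_odd_cells.
exact: mixing_odd_cells.
Qed.

Lemma pattern_fiber j S :
  [set x | pattern j x = S] = box (fun i => cell (i \in S) j).
Proof.
apply/seteqP; split=> x /=.
  move=> <- i; rewrite /cell inE; case: (pselect (odd_cells j (tnth x i))) => H.
    by rewrite mem_set.
  by rewrite memNset.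
move=> H; apply/setP => i; rewrite inE; move: (H i); rewrite /cell.
by case: ifP => _; move=> Hi; [rewrite mem_set|rewrite memNset].
Qed.

Lemma measurable_pattern_fiber j S : measurable [set x | pattern j x = S].
Proof.
by rewrite pattern_fiber; apply: measurable_box => i; exact: measurable_cell.
Qed.

Lemma vol_finite_box A :
  (forall i, measurable (A i) /\ (mu (A i) < +oo)%E) ->
  vol (box A) = (\prod_(i < n) fine (mu (A i)))%:E.
Proof.
move=> mA; rewrite /box vol_box; last by move=> i; case: (mA i).
rewrite -prodEFin; apply: eq_bigr => i _; rewrite fineK// ge0_fin_numE//.
by case: (mA i).
Qed.

(** On a finite box the volume factorizes and each of the [n] factors is halved in the limit; the
    pi-lambda argument extends this to all sets of finite volume. *)
Lemma mixing_pattern_fiber S E : measurable E -> (vol E < +oo)%E ->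
  mixing (@vol R n) (fun j => [set x | pattern j x = S]) (2 ^- n) E.
Proof.
move: E; have := @mixing_pi_lambda _ _ _ (@vol R n)
  (fun j => [set x | pattern j x = S]) (2 ^- n) finite_box cube.
apply => //.
- by rewrite invr_ge0 exprn_ge0//= invf_le1 ?exprn_gt0// exprn_ege1// ler1n.
- by move=> j; exact: measurable_pattern_fiber.
- exact: finite_box_measurable.
- exact: measurable_finite_box.
- exact: setI_closed_finite_box.
- move=> _ [A mA <-]; split; first by rewrite /= vol_finite_box// ltry.
  have mAc j i : measurable (A i `&` cell (i \in S) j) /\
      (mu (A i `&` cell (i \in S) j) < +oo)%E.
    have [mAi Aioo] := mA i.
    have mAij := measurableI _ _ mAi (measurable_cell (i \in S) j).
    by split=> //; apply: (sub_measure_lty Aioo).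
  rewrite /mixing; under eq_fun => j.
    rewrite pattern_fiber boxI /= vol_finite_box//=. over.
  rewrite /= vol_finite_box//=.
  rewrite (_ : 2 ^- n = \prod_(i < n) 2^-1 :> R); last first.
    by rewrite prodr_const card_ord exprVn.
  rewrite -big_split /=.
  apply: cvg_big; first by move=> x; exact: mul_continuous.
  by move=> i _; have [mAi Aioo] := mA i; exact: mixing_cell.
- exact: finite_box_cube.
- exact: nondecreasing_cube.
- exact: bigcup_cube.
Qed.

Lemma pattern_seq_cons j S (s : seq {set 'I_n}) :
  [set x | pattern j x \in S :: s] =
  [set x | pattern j x = S] `|` [set x | pattern j x \in s].
Proof. by apply/seteqP; split=> x /=; rewrite inE => H; exact/predU1P. Qed.

Lemma measurable_pattern_seq j (s : seq {set 'I_n}) :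
  measurable [set x | pattern j x \in s].
Proof.
elim: s => [|S s IHs]; last first.
  rewrite pattern_seq_cons.
  by apply: measurableU => //; exact: measurable_pattern_fiber.
by rewrite (_ : mkset _ = set0)//; apply/seteqP; split.
Qed.

(** Fibers of distinct patterns are disjoint, so their proportions add up; a duplicate-free list
    makes this an induction. *)
Lemma mixing_pattern_seq (s : seq {set 'I_n}) E :
  uniq s -> measurable E -> (vol E < +oo)%E ->
  mixing (@vol R n) (fun j => [set x | pattern j x \in s])
    ((size s)%:R * 2 ^- n) E.
Proof.
move=> + mE Eoo; elim: s => [_|S s IHs /= /andP[Ss us]].
  rewrite /mixing !mul0r; under eq_fun => j.
    rewrite (_ : [set x | _] = set0); last by apply/seteqP; split.
    rewrite setI0 measure0 /=. over.
  exact: cvg_cst.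
rewrite -natr1 [_%:R + 1]addrC mulrDl mul1r.
under [X in mixing _ X]eq_fun => j.
  rewrite pattern_seq_cons. over.
apply: mixing_setU => //.
- by move=> j; exact: measurable_pattern_fiber.
- by move=> j; exact: measurable_pattern_seq.
- by move=> j; apply/seteqP; split=> // x /= [-> /(negP Ss)].
- exact: mixing_pattern_fiber.
- exact: IHs.
Qed.

End Pattern.

(** * The three slices of K and the isoperimetric bound *)

Section Slices.
Context (R : realType) (n : nat).
Implicit Types F : {set {set 'I_n}}.

Definition pattern_in j F : set (n.-tuple R) := [set x | pattern j x \in F].

Lemma pattern_in_enum j F : pattern_in j F = [set x | pattern j x \in enum F].
Proof. by apply/seteqP; split=> x; rewrite /pattern_in /= mem_enum. Qed.

Lemma measurable_pattern_in j F : measurable (pattern_in j F).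
Proof. by rewrite pattern_in_enum; exact: measurable_pattern_seq. Qed.

Lemma mixing_pattern_in F E : measurable E -> (vol E < +oo)%E ->
  mixing (@vol R n) (fun j => pattern_in j F) (#|F|%:R * 2 ^- n) E.
Proof.
move=> mE Eoo; rewrite cardE (_ : (fun j => pattern_in j F) =
    fun j => [set x | pattern j x \in enum F]).
  by apply: mixing_pattern_seq => //; exact: enum_uniq.
by apply/funext => j; exact: pattern_in_enum.
Qed.

(** Two points differ at every coordinate that is odd for [y] and even for [x]. There are at least
    two of these, since the pattern sizes lie strictly on either side of [n./2]. *)
Lemma axis_disjoint_layers j :
  axis_disjoint (pattern_in j (lower_layers n)) (pattern_in j (upper_layers n)).
Proof.
move=> x y; rewrite /pattern_in /= !inE => lx ly.
have : (#|pattern j y :\: pattern j x| <=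
    l0 [tuple (tnth x i - tnth y i)%R | i < n])%N.
  apply: subset_leq_card; apply/fintype.subsetP => i.
  rewrite !inE tnth_mktuple subr_eq0.
  by case/andP=> xi yi; apply: contraNneq xi => ->.
apply: leq_trans; rewrite cardsD.
have := subset_leq_card (subsetIr (pattern j y) (pattern j x)).
by lia.
Qed.

(** After squaring, this is [middle_bin_sqr_le] weakened by n <= 2 [uphalf n] + 1. *)
Lemma middle_layer_density : (0 < n)%N ->
  #|middle_layer n|%:R * 2 ^- n <= (Num.sqrt n%:R)^-1 :> R.
Proof.
move=> n0; have s0 : 0 < Num.sqrt n%:R :> R by rewrite sqrtr_gt0 ltr0n.
rewrite ler_pdivrMr ?exprn_gt0// ler_pdivlMl// card_middle_layer.
rewrite -ler_sqr ?nnegrE ?mulr_ge0 ?exprn_ge0 ?sqrtr_ge0//.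
rewrite exprMn sqr_sqrtr// -!natrX -natrM ler_nat.
rewrite -expnM (mulnC n 2%N) (expnM 2 2).
apply: leq_trans (middle_bin_sqr_le n); rewrite mulnC leq_mul2l; lia.
Qed.

Lemma lower_layers_density : (1 < n)%N ->
  20^-1 <= #|lower_layers n|%:R * 2 ^- n :> R.
Proof.
move=> n1; rewrite ler_pdivlMr ?exprn_gt0// ler_pdivrMl//.
by rewrite -natrX -natrM ler_nat card_lower_layers.
Qed.

(** The lower and upper slices form an admissible pair and what they leave of [K] is the middle
    slice. The real bounds [m] and [s] leave room for estimates that hold only up to a factor at
    finite [j]. *)
Lemma psi_le_slice (K : set (n.-tuple R)) j (m s : R) :
  measurable K -> (vol K < +oo)%E -> 0 < s ->
  s <= fine (vol (K `&` pattern_in j (lower_layers n))) ->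
  s <= fine (vol (K `&` pattern_in j (upper_layers n))) ->
  fine (vol (K `&` pattern_in j (middle_layer n))) <= m ->
  (psi K <= (m / s)%:E)%E.
Proof.
move=> mK Koo s0; set L := K `&` _; set U := K `&` _; set M := K `&` _.
move=> sL sU Mm.
have mpat F : measurable (K `&` pattern_in j F).
  by apply: measurableI => //; exact: measurable_pattern_in.
have volE F : vol (K `&` pattern_in j F) =
    (fine (vol (K `&` pattern_in j F)))%:E.
  by rewrite fineK// ge0_fin_numE//; apply: (sub_measure_lty Koo).
have ME : K `\` (L `|` U) = M.
  rewrite /L /U /M /pattern_in; apply/seteqP; split=> x /=; rewrite !inE.
    case=> Kx H; split=> //; case: ltngtP => // H'; exfalso; apply: H.
      by left.
    by right.
  by case=> Kx /eqP ->; split=> // -[] [] _; rewrite ltnn.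
have min0 : 0 < Num.min (fine (vol L)) (fine (vol U)).
  by rewrite lt_min (lt_le_trans s0 sL) (lt_le_trans s0 sU).
have minE : mine (vol L) (vol U) = (Num.min (fine (vol L)) (fine (vol U)))%:E.
  by rewrite EFin_min /L /U -!volE.
apply: (@le_trans _ _ (vol M / mine (vol L) (vol U))%E).
  apply: ereal_inf_lbound; exists L, U; split.
    by split; [exact: mpat|exact: mpat|exact: subIsetl|exact: subIsetl].
  split; [|by rewrite minE lte_fin|by rewrite ME].
  by move=> x y [_ xL] [_ yU]; exact: axis_disjoint_layers xL yU.
(* The minimum is a nonzero real, so the extended quotient is an ordinary one. *)
rewrite minE inver gt_eqF// /M volE -EFinM lee_fin.
apply: ler_pM => //; first by rewrite fine_ge0.
  by rewrite invr_ge0 ltW.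
by rewrite lef_pV2 ?posrE// le_min sL.
Qed.

End Slices.

Theorem theorem1p4 (R : realType) :
  exists C : R, 0 < C /\
    forall (n : nat) (K : set (n.-tuple R)),
      (2 <= n)%N -> measurable K ->
      (0 < vol K)%E -> (vol K < +oo)%E ->
      (psi K <= (C * n%:R `^ (- 2^-1))%:E)%E.
Proof.
(* 80 is the quotient of 2, from the middle bound [2 * r * V], by 1/40, from the outer bound
   [V / 40]. *)
exists 80; split=> // n K n2 mK K0 Koo; have n0 : (0 < n)%N by lia.
rewrite powRN powR12_sqrt//; set r := (Num.sqrt n%:R)^-1.
have r0 : 0 < r by rewrite invr_gt0 sqrtr_gt0 ltr0n.
set V := fine (vol K); have V0 : 0 < V by rewrite fine_gt0// K0.
(* The limiting proportion is at least 1/20; halving it gives the strict slack needed to hold for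
   all large [j]. The middle bound is doubled for the same reason. *)
have tail (F : {set {set 'I_n}}) : (#|lower_layers n| <= #|F|)%N ->
    \forall j \near \oo, V / 40 <= fine (vol (K `&` pattern_in j F)).
  move=> LF; have := @mixing_pattern_in R n F K mK Koo.
  rewrite /mixing => /cvgr_ge; apply.
  have FV : 20^-1 * V <= #|F|%:R * 2 ^- n * V.
    rewrite ler_pM2r//; apply: le_trans (lower_layers_density R n2) _.
    by rewrite ler_pM2r ?invr_gt0 ?exprn_gt0// ler_nat.
  by apply: lt_le_trans FV; rewrite mulrC ltr_pM2r//; lra.
have middle : \forall j \near \oo,
    fine (vol (K `&` pattern_in j (middle_layer n))) <= 2 * r * V.
  have := @mixing_pattern_in R n (middle_layer n) K mK Koo.
  rewrite /mixing => /cvgr_le; apply.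
  rewrite ltr_pM2r//; apply: le_lt_trans (middle_layer_density R n0) _.
  by rewrite -/r; lra.
(* One [j] large enough for all three estimates suffices. *)
have [j _ /(_ j (leqnn j)) [[Lj Uj] Mj]] := filterI
  (filterI (tail _ (leqnn _)) (tail _ (card_lower_le_upper n))) middle.
have s0 : 0 < V / 40 by rewrite divr_gt0.
apply: le_trans (psi_le_slice mK Koo s0 Lj Uj Mj) _; rewrite lee_fin.
by rewrite ler_pdivrMr//; lra.
Qed.
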